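(* Suppose $fD=P\bar P$ with $P\neq\bar P$ prime ideals of $D$; let $m$ be the order of $P$ in the class group of $D$, let $\beta\in D$ be a generator of $P^m$, and put $t_k=f\beta^k$ and $Q_k=(f^k,t_k)$ for $k\ge 0$ (so $Q_0=O$, and $Q_k=P^k\bar P$ for $k\ge1$). (i) Let $Q$ be an $\mathfrak{F}$-basic ideal. Then there exists $k \geq 1$ such that $f Q_k\subsetneq Q\subseteq Q_k$. (ii) The ideals $Q_k = (f^{k}, t_k)$, for $k\in\mathbb{N}$, are pairwise distinct. (iii) An ideal $Q$ of $O$ contains $Q_k$ if and only if $Q \in \{Q_i : i=0,\ldots,k\}$. (iv) If $Q$ contains a basic element and it is not principal, then either $Q= Q_k$ or $Q=\overline{Q_k}$ for some $k \in\mathbb{N}$.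
   Context: Let $d$ be a square-free integer ($d\neq 1$), $K=\mathbb{Q}(\sqrt d)$ and $D=\mathbb{Z}[\omega]$ its ring of integers, where $\omega=\sqrt d$ if $d\equiv 2,3 \pmod 4$ and $\omega=(1+\sqrt d)/2$ if $d\equiv 1\pmod 4$. Let $f$ be a prime number and $O=\mathbb{Z}[f\omega]$, the unique order of $K$ with $[D:O]=f$. The conductor of $O$ is $\mathfrak{F}=\{x\in O: xD\subseteq O\}=fD$; it is a prime ideal of $O$. Throughout, $Q$ denotes an ideal of $O$. An ideal of $O$ is $\mathfrak{F}$-primary if it is primary with radical $\mathfrak{F}$; an $\mathfrak{F}$-primary ideal is $\mathfrak{F}$-basic if it is not contained in $\mathfrak{F}^2$. An element $t\in O$ is basic if $tO$ is an $\mathfrak{F}$-basic ideal. For $\alpha,\gamma\in O$, $(\alpha,\gamma)=\alpha O+\gamma O$. A bar denotes conjugation in $K$. The order $m$ of $P$ is the least positive integer such that $P^m$ is principal.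
   Formalization: Part (i) as written is false (d = -1, f = 5, P = (2+i), Q = conjugate of Q_3); it is proved in the form: for some k ≥ 1, either f Q_k ⊊ Q ⊆ Q_k, or the same inclusions hold with the conjugate of Q_k in place of Q_k. *)

(* Defs.v *)
From HB Require Import structures.
From mathcomp Require Import all_boot all_order all_algebra all_field.
From mathcomp Require Import boolp classical_sets.

Set Implicit Arguments.
Unset Strict Implicit.
Unset Printing Implicit Defensive.

Import Order.TTheory GRing.Theory Num.Theory.
Local Open Scope classical_set_scope.
Local Open Scope ring_scope.

(* Rings A and their ideals are sets of complex algebraic numbers, so that
   ideals of an order O and of the maximal order D live in the same type. *)

Definition is_ideal (A I : set algC) : Prop :=
  [/\ I `<=` A, I 0, forall x y, I x -> I y -> I (x + y)
    & forall a x, A a -> I x -> I (a * x)].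

Definition scale_ideal (a : algC) (I : set algC) : set algC :=
  [set a * x | x in I].

Definition ideal2 (A : set algC) (a b : algC) : set algC :=
  [set x + y | x in scale_ideal a A & y in scale_ideal b A].

Definition is_principal (A I : set algC) : Prop :=
  exists2 a, A a & I = scale_ideal a A.

(* Finite sums of products; the ambient ring plays no role. *)
Definition ideal_mul (I J : set algC) : set algC :=
  [set x | exists2 s : seq (algC * algC),
     (forall p, p \in s -> I p.1 /\ J p.2) & x = \sum_(p <- s) p.1 * p.2].

Definition ideal_exp (A I : set algC) (n : nat) : set algC :=
  iter n (ideal_mul I) A.

Definition is_prime_ideal (A I : set algC) : Prop :=
  [/\ is_ideal A I, I <> A
    & forall x y, A x -> A y -> I (x * y) -> I x \/ I y].

Definition radical (A I : set algC) : set algC :=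
  [set x | A x /\ exists n, I (x ^+ n)].

Definition is_primary (A I : set algC) : Prop :=
  [/\ is_ideal A I, I <> A
    & forall x y, A x -> A y -> I (x * y) -> I x \/ exists n, I (y ^+ n)].

Definition squarefreez (d : int) : Prop :=
  forall n : int, (n ^+ 2 %| d)%Z -> n \is a GRing.unit.

Definition sqrtz (d : int) : algC := sqrtC d%:~R.

(* The case d = 0 mod 4 is irrelevant, d being square-free. *)
Definition quad_omega (d : int) : algC :=
  if (d == 1 %[mod 4])%Z then (1 + sqrtz d) / 2 else sqrtz d.

Definition Zadjoin (x : algC) : set algC :=
  [set (map_poly intr p).[x] | p in [set: {poly int}]].

Definition quad_maxorder (d : int) : set algC := Zadjoin (quad_omega d).

Definition quad_order (d : int) (f : nat) : set algC := Zadjoin (f%:R * quad_omega d).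

Definition conductor (d : int) (f : nat) : set algC :=
  [set x | quad_order d f x /\ scale_ideal x (quad_maxorder d) `<=` quad_order d f].

(* Image of I under the conjugation of Q(sqrt d), which differs from complex
   conjugation when d > 0. *)
Definition conj_ideal (d : int) (I : set algC) : set algC :=
  [set x | exists a b : rat,
     I (ratr a + ratr b * sqrtz d) /\ x = ratr a - ratr b * sqrtz d].

Definition F_primary (d : int) (f : nat) (I : set algC) : Prop :=
  is_primary (quad_order d f) I /\ radical (quad_order d f) I = conductor d f.

Definition F_basic (d : int) (f : nat) (I : set algC) : Prop :=
  F_primary d f I /\
  ~ (I `<=` ideal_exp (quad_order d f) (conductor d f) 2).

Definition basic_elt (d : int) (f : nat) (t : algC) : Prop :=
  quad_order d f t /\ F_basic d f (scale_ideal t (quad_order d f)).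

Definition is_class_order (A P : set algC) (m : nat) : Prop :=
  [/\ (0 < m)%N, is_principal A (ideal_exp A P m)
    & forall n, (0 < n)%N -> is_principal A (ideal_exp A P n) -> (m <= n)%N].

Definition tk (f : nat) (beta : algC) (k : nat) : algC := f%:R * beta ^+ k.

Definition Qk (d : int) (f : nat) (beta : algC) (k : nat) : set algC :=
  ideal2 (quad_order d f) (f%:R ^+ k) (tk f beta k).

(* Main.v *)
Require Import Defs.
From HB Require Import structures.
From mathcomp Require Import all_boot all_order all_algebra all_field.
From mathcomp Require Import boolp classical_sets.
From mathcomp Require Import ring.

Set Implicit Arguments.
Unset Strict Implicit.
Unset Printing Implicit Defensive.

Import Order.TTheory GRing.Theory Num.Theory.
Local Open Scope classical_set_scope.
Local Open Scope ring_scope.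

(** Let P' be the conjugate of P and let O = Z + f D. Since P P' = f D, the
    ideal Q_k is P^k P' = f P^(k-1) for k > 0, so everything is read off from
    the powers of P in D.

    Two observations carry the proof. First, Z maps onto D/P^k with kernel
    generated by f^k (split_exp_res, split_exp_int), so D/P^k is the ring
    Z/f^k and the ideals of D containing P^k are the P^i with i <= k. The same
    holds for O/Q_k, which is Z/f^k again; this is (iii), and the least power
    of f in Q_k determines k, which is (ii). Both instances come from
    chain_of_ideals.

    Second, an ideal of D that contains a power of f but is not inside
    f D = P P' is not inside P or not inside P', hence is comaximal with that
    one, hence is a power of the other (split_ideal_classify). If Q is F-basic, then Q D is f times
    such an ideal, so Q D is some Q_k or its conjugate, and f Q D lies in Q
    because f D lies in O: this is (i).

    For (iv), let t in Q be basic. Then t D is some Q_k or its conjugate, by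
    the second observation. Since D/O has prime order f, an ideal Q strictly
    larger than t O already contains t D (principal_or_over), and (iii) applies
    to Q or, with P and P' exchanged, to its conjugate. *)

(** * Subrings and their ideals *)

Definition is_subring (A : set algC) : Prop :=
  [/\ A 1, forall x y, A x -> A y -> A (x - y)
    & forall x y, A x -> A y -> A (x * y)].

Lemma subring1 A : is_subring A -> A 1.
Proof. by case. Qed.

Lemma subringB A x y : is_subring A -> A x -> A y -> A (x - y).
Proof. by case=> _ AB _; apply: AB. Qed.

Lemma subringM A x y : is_subring A -> A x -> A y -> A (x * y).
Proof. by case=> _ _; apply. Qed.

Lemma subring0 A : is_subring A -> A 0.
Proof.
by move=> rA; rewrite -(subrr 1); apply: (subringB rA (subring1 rA) (subring1 rA)).
Qed.

Lemma subringN A x : is_subring A -> A x -> A (- x).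
Proof. by move=> rA Ax; rewrite -sub0r; apply: (subringB rA (subring0 rA) Ax). Qed.

Lemma subringD A x y : is_subring A -> A x -> A y -> A (x + y).
Proof.
by move=> rA Ax Ay; rewrite -[y]opprK; apply: (subringB rA Ax (subringN rA Ay)).
Qed.

Lemma subringX A x n : is_subring A -> A x -> A (x ^+ n).
Proof.
move=> rA Ax; elim: n => [|n IHn]; first exact: subring1.
by rewrite exprS; apply: subringM.
Qed.

Lemma subring_int A (c : int) : is_subring A -> A c%:~R.
Proof.
move=> rA; have nat_in n : A n%:R.
  elim: n => [|n IHn]; first exact: subring0.
  by rewrite -addn1 natrD; apply: (subringD rA) => //; apply: (subring1 rA).
case: c => n; first exact: nat_in.
by rewrite NegzE mulrNz; apply: (subringN rA (nat_in _)).
Qed.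

Lemma subring_nat A n : is_subring A -> A n%:R.
Proof. by move=> rA; apply: (@subring_int A n). Qed.

Lemma subring_sum A n (F : nat -> algC) :
  is_subring A -> (forall i, A (F i)) -> A (\sum_(i < n) F i).
Proof.
move=> rA AF; apply: (big_ind A) => //; first exact: subring0.
by move=> x y; apply: subringD.
Qed.

Lemma ideal_sub A I x : is_ideal A I -> I x -> A x.
Proof. by case=> IA _ _ _; apply: IA. Qed.

Lemma ideal0 A I : is_ideal A I -> I 0.
Proof. by case. Qed.

Lemma idealD A I x y : is_ideal A I -> I x -> I y -> I (x + y).
Proof. by case=> _ _ ID _; apply: ID. Qed.

Lemma idealMl A I a x : is_ideal A I -> A a -> I x -> I (a * x).
Proof. by case=> _ _ _; apply. Qed.

Lemma idealMr A I a x : is_ideal A I -> A a -> I x -> I (x * a).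
Proof. by rewrite mulrC => iI Aa; apply: (idealMl iI Aa). Qed.

Lemma idealB A I x y : is_subring A -> is_ideal A I -> I x -> I y -> I (x - y).
Proof.
move=> rA iI Ix Iy; rewrite -[- y]mulN1r.
exact: (idealD iI Ix (idealMl iI (subringN rA (subring1 rA)) Iy)).
Qed.

Lemma ideal1 A I : is_ideal A I -> I 1 -> I = A.
Proof.
move=> iI I1; apply/seteqP; split=> x; first exact: ideal_sub.
by move=> Ax; rewrite -[x]mulr1; apply: (idealMl iI Ax I1).
Qed.

Lemma subring_ideal A : is_subring A -> is_ideal A A.
Proof.
move=> rA; split=> // [|x y|a x]; first exact: subring0.
  exact: subringD.
exact: subringM.
Qed.

(** An ideal meets the integers in a subgroup, so Euclid's algorithm runs
    inside it. *)
Lemma ideal_gcd A I (a b : int) : is_subring A -> is_ideal A I ->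
  I a%:~R -> I b%:~R -> I (gcdz a b)%:~R.
Proof.
move=> rA iI Ia Ib; have [u [v <-]] := Bezoutz a b.
rewrite intrD !intrM.
by apply: (idealD iI); apply: (idealMl iI) => //; exact: (subring_int _ rA).
Qed.

Lemma prime_Bezout (f : nat) (c : int) : prime f -> ~~ (f %| c)%Z ->
  exists u v : int, u%:~R * c%:~R = 1 + v%:~R * f%:R :> algC.
Proof.
move=> pf Nfc; have [u [v]] := Bezoutz c f.
have -> : gcdz c f = 1.
  by apply/eqP; rewrite -/(coprimez c f) coprimezE coprime_sym prime_coprime.
move=> uv; exists u, (- v); rewrite -intrM mulrNz mulNr.
have -> : v%:~R * f%:R = (v * f)%:~R :> algC by rewrite intrM.
rewrite -[1]/(1%:~R) -intrB; congr (1 *~ _); by rewrite -[X in _ = X - _]uv addrK.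
Qed.

Lemma scale_ideal_ideal A I a :
  A a -> is_subring A -> is_ideal A I -> is_ideal A (scale_ideal a I).
Proof.
move=> Aa rA iI; split.
- by move=> _ [x Ix <-]; apply: (subringM rA Aa (ideal_sub iI Ix)).
- by exists 0; [apply: (ideal0 iI) | rewrite mulr0].
- move=> _ _ [x Ix <-] [y Iy <-]; exists (x + y); last by rewrite mulrDr.
  exact: (idealD iI Ix Iy).
- move=> b _ Ab [x Ix <-]; exists (b * x); last by rewrite mulrCA.
  exact: (idealMl iI Ab Ix).
Qed.

Lemma scale_ideal_cancel I (a x : algC) : a != 0 -> scale_ideal a I (a * x) -> I x.
Proof. by move=> a0 [y Iy /(mulfI a0) <-]. Qed.

(** K is only asked to be additive, not to be an ideal: below it is often the
    preimage of an ideal under multiplication by a fixed element. *)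
Lemma ideal_mul_sub (I J K : set algC) : K 0 -> (forall x y, K x -> K y -> K (x + y)) ->
  (forall x y, I x -> J y -> K (x * y)) -> ideal_mul I J `<=` K.
Proof.
move=> K0 KD KM _ [s sIJ ->]; rewrite big_seq.
apply: (big_ind K) => // p /sIJ[Ip Jp]; exact: KM.
Qed.

Lemma ideal_mul_mem (I J : set algC) x y : I x -> J y -> ideal_mul I J (x * y).
Proof.
move=> Ix Jy; exists [:: (x, y)]; last by rewrite big_seq1.
by move=> p; rewrite inE => /eqP->.
Qed.

Lemma ideal_mulD (I J : set algC) x y :
  ideal_mul I J x -> ideal_mul I J y -> ideal_mul I J (x + y).
Proof.
case=> [s sIJ ->] [t tIJ ->]; exists (s ++ t); last by rewrite big_cat.
by move=> p; rewrite mem_cat => /orP[/sIJ|/tIJ].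
Qed.

Lemma ideal_mul0 (I J : set algC) : ideal_mul I J 0.
Proof. by exists [::]; last by rewrite big_nil. Qed.

Lemma ideal_mulC (I J : set algC) : ideal_mul I J = ideal_mul J I.
Proof.
suff sub U V : ideal_mul U V `<=` ideal_mul V U by apply/seteqP; split; apply: sub.
apply: ideal_mul_sub => [|x y|x y Ux Vy]; first exact: ideal_mul0.
  exact: ideal_mulD.
by rewrite mulrC; apply: ideal_mul_mem.
Qed.

Lemma ideal_mul_ideal A I J : is_subring A -> I `<=` A -> is_ideal A J ->
  is_ideal A (ideal_mul I J).
Proof.
move=> rA IA iJ; split.
- apply: ideal_mul_sub => [|x y|x y Ix Jy]; first exact: subring0.
    exact: subringD.
  by apply: subringM => //; [apply: IA | apply: (ideal_sub iJ Jy)].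
- exact: ideal_mul0.
- by move=> x y; apply: ideal_mulD.
move=> a x Aa; move: x; apply: ideal_mul_sub => [|x y Kx Ky|x y Ix Jy].
- by rewrite mulr0; apply: ideal_mul0.
- by rewrite mulrDr; apply: ideal_mulD.
by rewrite mulrCA; apply: ideal_mul_mem => //; apply: (idealMl iJ Aa Jy).
Qed.

Lemma ideal_exp_ideal A I n : is_subring A -> I `<=` A -> is_ideal A (ideal_exp A I n).
Proof.
by move=> rA IA; elim: n => [|n]; [apply: subring_ideal | apply: ideal_mul_ideal].
Qed.

(** If Z surjects onto each quotient A/I_k and the kernel is generated by
    f^k, then A/I_k is the ring Z/f^k, whose ideals form the finite chain
    generated by the powers of f. *)
Lemma chain_of_ideals (A : set algC) (I_ : nat -> set algC) (f : nat) :
  prime f -> is_subring A -> (forall k, is_ideal A (I_ k)) ->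
  (forall i j, (i <= j)%N -> I_ j `<=` I_ i) ->
  (forall k, I_ k (f%:R ^+ k)) ->
  (forall k (c : int), I_ k c%:~R -> ((f ^ k)%N %| c)%Z) ->
  (forall k x, A x -> exists c : int, I_ k (x - c%:~R)) ->
  forall k Q, is_ideal A Q -> I_ k `<=` Q -> exists2 i, (i <= k)%N & Q = I_ i.
Proof.
move=> pf rA iI Idecr If Iint Ires k Q iQ kQ.
have exQ : exists i, `[< Q (f%:R ^+ i) >] by exists k; apply/asboolP/kQ.
case: (ex_minnP exQ) => i /asboolP Qi imin.
have leik : (i <= k)%N by apply/imin/asboolP/kQ.
exists i => //.
have split_mod x : A x -> exists2 c : int, I_ k (x - c%:~R) & x = c%:~R + (x - c%:~R).
  by case/(Ires k)=> c Ic; exists c => //; rewrite addrC subrK.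
have dvd_mem (J : set algC) (c : int) : is_ideal A J -> J (f%:R ^+ i) ->
    ((f ^ i)%N %| c)%Z -> J c%:~R.
  move=> iJ Ji /dvdzP[e ->]; rewrite intrM; apply: (idealMl iJ (subring_int _ rA) _).
  by rewrite -natrX in Ji.
apply/seteqP; split=> x.
  move=> Qx; have [c Ic ->] := split_mod x (ideal_sub iQ Qx).
  apply: (idealD (iI i)); last exact: (Idecr _ _ leik _ Ic).
  apply: dvd_mem => //.
  have Qc : Q c%:~R.
    have -> : c%:~R = x - (x - c%:~R) by rewrite opprB addrC subrK.
    by apply: (idealB rA iQ Qx (kQ _ Ic)).
  have := ideal_gcd rA iQ Qc (_ : Q ((f ^ k)%N%:Z)%:~R).
  have -> : ((f ^ k)%N%:Z)%:~R = f%:R ^+ k :> algC by rewrite -natrX.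
  move=> /(_ (kQ _ (If k))).
  rewrite /gcdz /=.
  have /(dvdn_pfactor _ _ pf)[v _ gE] := dvdn_gcdr `|c|%N (f ^ k)%N.
  rewrite gE -pmulrn natrX => /asboolP/imin leiv.
  rewrite dvdzE /=; apply: (dvdn_trans _ (dvdn_gcdl `|c|%N (f ^ k)%N)).
  by rewrite gE; apply: dvdn_exp2l.
move=> Ix; have [c Ic ->] := split_mod x (ideal_sub (iI i) Ix).
apply: (idealD iQ); last exact: kQ.
apply: dvd_mem => //; apply: Iint.
have -> : c%:~R = x - (x - c%:~R) by rewrite opprB addrC subrK.
by apply: (idealB rA (iI i) Ix (Idecr _ _ leik _ Ic)).
Qed.

(** * Powers of a split prime *)

(** Since D/I is the field of integers mod f. *)
Lemma residue_inv (D I : set algC) (f : nat) : prime f -> is_subring D ->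
    is_ideal D I -> I f%:R -> (forall x, D x -> exists c : int, I (x - c%:~R)) ->
  forall x, D x -> ~ I x -> exists u : int, I (u%:~R * x - 1).
Proof.
move=> pf rD iI If res x Dx NIx; have [c Ixc] := res x Dx.
have Nfc : ~~ (f %| c)%Z.
  apply/negP => /dvdzP[e cE]; apply: NIx.
  have -> : x = (x - c%:~R) + e%:~R * f%:R by rewrite cE intrM subrK.
  exact: (idealD iI Ixc (idealMl iI (subring_int _ rD) If)).
have [u [v uv]] := prime_Bezout pf Nfc; exists u.
have -> : u%:~R * x - 1 = u%:~R * (x - c%:~R) + v%:~R * f%:R.
  by rewrite mulrBr uv; ring.
apply: (idealD iI); first exact: (idealMl iI (subring_int _ rD) Ixc).
exact: (idealMl iI (subring_int _ rD) If).
Qed.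

(** The situation of a prime number f split in a ring D with f D = P P': only
    these properties of D, P, P' matter below, and they are symmetric in P
    and P'. *)
Record split_prime (D P P' : set algC) (f : nat) : Prop := SplitPrime {
  split_prime_nat : prime f;
  split_ring : is_subring D;
  split_ideall : is_ideal D P;
  split_idealr : is_ideal D P';
  split_properl : ~ P 1;
  split_properr : ~ P' 1;
  split_resl : forall x, D x -> exists c : int, P (x - c%:~R);
  split_resr : forall x, D x -> exists c : int, P' (x - c%:~R);
  split_comax : exists2 p, P p & P' (1 - p);
  split_mul : scale_ideal f%:R D = ideal_mul P P'
}.

Lemma split_sym D P P' f : split_prime D P P' f -> split_prime D P' P f.
Proof.
case=> pf rD iP iP' P1 P'1 resl resr [p Pp P'p] mulE; split=> //.
  by exists (1 - p) => //; rewrite opprB addrC subrK.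
by rewrite mulE ideal_mulC.
Qed.

Section SplitPrime.
Context (D P P' : set algC) (f : nat).
Hypothesis sp : split_prime D P P' f.

Let pf := split_prime_nat sp.
Let rD := split_ring sp.
Let iP := split_ideall sp.
Let iP' := split_idealr sp.

Lemma split_natr_neq0 : f%:R != 0 :> algC.
Proof. by rewrite pnatr_eq0 -lt0n prime_gt0. Qed.

Lemma split_mulP x y : P x -> P' y -> scale_ideal f%:R D (x * y).
Proof. by rewrite (split_mul sp); apply: ideal_mul_mem. Qed.

Lemma split_fl : P f%:R.
Proof.
have: scale_ideal f%:R D f%:R by exists 1; [apply: subring1 | rewrite mulr1].
rewrite (split_mul sp); apply: ideal_mul_sub => [|x y|x y Px P'y].
- exact: (ideal0 iP).
- exact: (idealD iP).
exact: (idealMr iP (ideal_sub iP' P'y) Px).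
Qed.

(** P and P' are comaximal, so their intersection is their product. *)
Lemma split_cap x : P x -> P' x -> scale_ideal f%:R D x.
Proof.
move=> Px P'x; have [p Pp P'p] := split_comax sp.
have -> : x = p * x + x * (1 - p) by ring.
rewrite (split_mul sp); apply: ideal_mulD; first exact: ideal_mul_mem.
exact: ideal_mul_mem.
Qed.

Lemma split_int (c : int) : P c%:~R -> (f %| c)%Z.
Proof.
move=> Pc; apply/negPn/negP => /(prime_Bezout pf)[u [v uv]].
apply: (split_properl sp).
have -> : 1 = u%:~R * c%:~R - v%:~R * f%:R :> algC by rewrite uv addrK.
by apply: (idealB rD iP); apply: (idealMl iP) => //;
  [apply: (subring_int _ rD) | apply: (subring_int _ rD) | apply: split_fl].
Qed.

Lemma split_inv x : D x -> ~ P x -> exists u : int, P (u%:~R * x - 1).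
Proof. exact: (residue_inv pf rD iP split_fl (split_resl sp)). Qed.

Local Notation "P ^: n" := (ideal_exp D P n) (at level 30).

Lemma split_exp_ideal n : is_ideal D (P ^: n).
Proof. exact: (ideal_exp_ideal _ rD (fun x => @ideal_sub _ _ x iP)). Qed.

Lemma split_expX x n : P x -> (P ^: n) (x ^+ n).
Proof.
move=> Px; elim: n => [|n IHn]; first exact: subring1.
by rewrite exprS; apply: ideal_mul_mem.
Qed.

Lemma split_expS n : P ^: n.+1 `<=` P ^: n.
Proof.
apply: ideal_mul_sub => [|x y|x y Px Py].
- exact: (ideal0 (split_exp_ideal n)).
- exact: (idealD (split_exp_ideal n)).
exact: (idealMl (split_exp_ideal n) (ideal_sub iP Px) Py).
Qed.

Lemma split_exp_decr m n : (m <= n)%N -> P ^: n `<=` P ^: m.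
Proof.
move=> /subnKC <-; elim: (n - m)%N => [|k IHk]; first by rewrite addn0.
by rewrite addnS => x /split_expS/IHk.
Qed.

Lemma split_exp1 : P ^: 1 `<=` P.
Proof.
apply: ideal_mul_sub => [|x y|x y Px Dy]; [exact: (ideal0 iP) | exact: (idealD iP) |].
exact: (idealMr iP Dy Px).
Qed.

(** Multiplying by P' cancels one factor P against a factor f. *)
Lemma split_expM_conj n : ideal_mul (P ^: n.+1) P' = scale_ideal f%:R (P ^: n).
Proof.
have iPn := split_exp_ideal n; apply/seteqP; split.
  have f_in := subring_nat f rD.
  have ifPn := scale_ideal_ideal f_in rD iPn.
  apply: ideal_mul_sub => [|x y|x y + P'y]; [exact: (ideal0 ifPn) | exact: (idealD ifPn) |].
  move: x; apply: ideal_mul_sub => [|x z|x z Px Pnz].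
  - by rewrite mul0r; apply: (ideal0 ifPn).
  - by rewrite mulrDl; apply: (idealD ifPn).
  have [w Dw xyE] := split_mulP Px P'y.
  by exists (w * z); [apply: (idealMl iPn Dw Pnz) | rewrite mulrA xyE mulrAC].
move=> _ [x Pnx <-].
have: scale_ideal f%:R D f%:R by exists 1; [apply: subring1 | rewrite mulr1].
rewrite (split_mul sp).
apply: (@ideal_mul_sub _ _ (fun z => ideal_mul (P ^: n.+1) P' (z * x))).
- by rewrite mul0r; apply: ideal_mul0.
- by move=> y z; rewrite mulrDl; apply: ideal_mulD.
by move=> y z Py P'z; rewrite mulrAC; apply: ideal_mul_mem => //; apply: ideal_mul_mem.
Qed.

Lemma split_exp_mul_conj n x y :
  (P ^: n.+1) x -> P' y -> scale_ideal f%:R (P ^: n) (x * y).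
Proof. by rewrite -split_expM_conj; apply: ideal_mul_mem. Qed.

Lemma split_exp_mulX n x w : (P ^: n) x -> P' w -> scale_ideal (f%:R ^+ n) D (x * w ^+ n).
Proof.
elim: n x => [|n IHn] x Px P'w; first by exists x; rewrite // expr0 mul1r mulr1.
have [z Pz xwE] := split_exp_mul_conj Px P'w.
have [t Dt ztE] := IHn _ Pz P'w.
by exists t; rewrite // exprS -mulrA ztE mulrA xwE exprS mulrA.
Qed.

Lemma split_expf n x : (P ^: n) x -> (P ^: n.+1) (f%:R * x).
Proof. by apply: ideal_mul_mem; apply: split_fl. Qed.

(** As 1 = p^n + (1 - p) r, being in P^n can be tested after multiplication by
    the element 1 - p of P', where f cancels. *)
Lemma split_exp_cancel n x : D x -> (P ^: n.+1) (f%:R * x) -> (P ^: n) x.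
Proof.
move=> Dx Pfx; have [p Pp P'p] := split_comax sp; have iPn := split_exp_ideal n.
have Pxp : (P ^: n) (x * (1 - p)).
  apply: (scale_ideal_cancel split_natr_neq0); rewrite mulrA.
  exact: split_exp_mul_conj.
have -> : x = x * p ^+ n + (x * (1 - p)) * \sum_(i < n) p ^+ i.
  have := subrX1 p n; set s := \sum_(i < n) _ => E.
  have {1}-> : x = x * p ^+ n - x * (p ^+ n - 1) by ring.
  by rewrite E; ring.
apply: (idealD iPn); first by apply: (idealMl iPn Dx); apply: split_expX.
apply: (idealMr iPn _ Pxp); apply: (@subring_sum _ _ (fun i => p ^+ i)) => // i.
exact: (subringX _ rD (ideal_sub iP Pp)).
Qed.

Lemma split_exp_int n (c : int) : (P ^: n) c%:~R -> ((f ^ n)%N %| c)%Z.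
Proof.
elim: n c => [|n IHn] c; first by rewrite expn0 dvd1z.
move=> Pc; have /dvdzP[e cE] : (f %| c)%Z.
  by apply: split_int; apply: split_exp1; apply: (split_exp_decr _ Pc).
move: Pc; rewrite cE intrM mulrC => /(split_exp_cancel (subring_int _ rD))/IHn.
by rewrite expnS PoszM mulrC; apply: dvdz_mul.
Qed.

(** From 1 = p + (1 - p) one gets P^n = P^(n+1) + P^n P', where P^n P' is
    f P^(n-1); a residue of P^(n-1) mod P^n thus lifts to one of P^n mod
    P^(n+1). *)
Lemma split_exp_res n x : D x -> exists c : int, (P ^: n) (x - c%:~R).
Proof.
elim: n x => [|n IHn] x Dx.
  by exists 0; rewrite subr0.
have iPn := split_exp_ideal n.+1.
case: n IHn iPn => [|n] IHn iPn.
  have [c Pc] := split_resl sp Dx; exists c.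
  by rewrite -[x - _]mulr1; apply: ideal_mul_mem => //; apply: (subring1 rD).
have [c] := IHn x Dx; set y := x - _ => Py.
have [p Pp P'p] := split_comax sp.
have [z Pz yE] := split_exp_mul_conj Py P'p.
have Dz := ideal_sub (split_exp_ideal n) Pz.
have [e Pe] := IHn z Dz.
exists (c + e * f).
have -> : x - (c + e * f)%:~R = p * y + f%:R * (z - e%:~R).
  by rewrite [f%:R * _]mulrBr yE intrD intrM /y -pmulrn; ring.
by apply: (idealD iPn); [apply: ideal_mul_mem | apply: split_expf].
Qed.

Lemma split_exp_f n : (P ^: n) (f%:R ^+ n).
Proof. exact/split_expX/split_fl. Qed.

Lemma split_over_exp k I : is_ideal D I -> P ^: k `<=` I ->
  exists2 i, (i <= k)%N & I = P ^: i.
Proof.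
apply: (chain_of_ideals pf rD) => [|i j|n|n c|n x].
- exact: split_exp_ideal.
- exact: split_exp_decr.
- exact: split_exp_f.
- exact: split_exp_int.
exact: split_exp_res.
Qed.

End SplitPrime.

(** Such an I is comaximal with P', hence with P'^n; as P^n P'^n = f^n D lies
    in I, so does P^n. *)
Lemma split_ideal_not_sub D P P' f n I x : split_prime D P P' f -> is_ideal D I ->
  I (f%:R ^+ n) -> I x -> ~ P' x -> exists a, I = ideal_exp D P a.
Proof.
move=> sp iI In Ix NP'x; have rD := split_ring sp.
suff sub : ideal_exp D P n `<=` I.
  by have [a _ ->] := split_over_exp sp iI sub; exists a.
have [u P'u] := split_inv (split_sym sp) (ideal_sub iI Ix) NP'x.
move=> y Py; set w := 1 - u%:~R * x.
have P'w : P' w.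
  rewrite /w -opprB -mulN1r; apply: (idealMl (split_idealr sp) _ P'u).
  exact: (subringN rD (subring1 rD)).
have Dw := ideal_sub (split_idealr sp) P'w.
have Dy := ideal_sub (split_exp_ideal sp n) Py.
have -> : y = y * w ^+ n + (y * \sum_(i < n) w ^+ i * u%:~R) * x.
  have := subrX1 w n; set s := \sum_(i < n) _ => E.
  have {1}-> : y = y * w ^+ n - y * (w ^+ n - 1) by ring.
  rewrite E -mulr_suml -/s.
  have -> : w - 1 = - (u%:~R * x) by rewrite /w; ring.
  by ring.
have [z Dz <-] := split_exp_mulX sp Py P'w.
apply: (idealD iI); first exact: (idealMr iI Dz In).
apply: (idealMl iI _ Ix); apply: (subringM rD Dy).
apply: (@subring_sum _ _ (fun i => w ^+ i * u%:~R)) => // i.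
exact: (subringM rD (subringX _ rD Dw) (subring_int _ rD)).
Qed.

(** Outside f D means outside P or outside P', as f D is their intersection. *)
Lemma split_ideal_classify D P P' f n I : split_prime D P P' f -> is_ideal D I ->
  I (f%:R ^+ n) -> ~ I `<=` scale_ideal f%:R D ->
  exists a, I = ideal_exp D P a \/ I = ideal_exp D P' a.
Proof.
move=> sp iI In NIf.
have [x [Ix Nfx]] := nonsubset NIf.
have [P'x|NP'x] := pselect (P' x); last first.
  by have [a ->] := split_ideal_not_sub sp iI In Ix NP'x; exists a; left.
have NPx : ~ P x by move=> Px; apply/Nfx/(split_cap sp).
by have [a ->] := split_ideal_not_sub (split_sym sp) iI In Ix NPx; exists a; right.
Qed.

(** * The order of conductor f *)

Definition order_of_conductor (D : set algC) (f : nat) : set algC :=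
  [set x | exists c : int, scale_ideal f%:R D (x - c%:~R)].

Lemma order_sub D f : is_subring D -> order_of_conductor D f `<=` D.
Proof.
move=> rD x [c [y Dy xE]]; rewrite -(subrK c%:~R x) -xE.
by apply: (subringD rD _ (subring_int _ rD)); apply: (subringM rD (subring_nat _ rD) Dy).
Qed.

Lemma order_conductor D f x : scale_ideal f%:R D x -> order_of_conductor D f x.
Proof. by move=> fx; exists 0; rewrite subr0. Qed.

Lemma conductor_ideal D f : is_subring D -> is_ideal D (scale_ideal f%:R D).
Proof.
by move=> rD; apply: (scale_ideal_ideal (subring_nat f rD) rD (subring_ideal rD)).
Qed.

Lemma order_subring D f : is_subring D -> is_subring (order_of_conductor D f).
Proof.
move=> rD; have iF := conductor_ideal f rD; split.
- by exists 1; rewrite subrr; apply: (ideal0 iF).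
- move=> x y [a Fx] [b Fy]; exists (a - b); rewrite intrB.
  have -> : x - y - (a%:~R - b%:~R) = (x - a%:~R) - (y - b%:~R) by ring.
  exact: (idealB rD iF Fx Fy).
move=> x y [a Fx] [b Fy]; exists (a * b); rewrite intrM.
have -> : x * y - a%:~R * b%:~R = (x - a%:~R) * y + a%:~R * (y - b%:~R) by ring.
have Dy : D y by apply: (order_sub rD (f := f)); exists b.
apply: (idealD iF); first exact: (idealMr iF Dy Fx).
exact: (idealMl iF (subring_int _ rD) Fy).
Qed.

Lemma ideal_restrict D O I : O `<=` D -> I `<=` O -> is_ideal D I -> is_ideal O I.
Proof.
by move=> OD IO [_ I0 ID IM]; split=> // a x Oa; apply: IM; apply: OD.
Qed.

Lemma scale_idealS a I J : I `<=` J -> scale_ideal a I `<=` scale_ideal a J.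
Proof. by move=> IJ _ [x Ix <-]; exists x => //; apply: IJ. Qed.

(** f P^j is P^(j+1) P', in a form where f cancels at once. The order itself
    completes the chain at k = 0, where P^k P' would give P', which is not
    inside the order. *)
Definition basic_chain (D P : set algC) (f k : nat) : set algC :=
  if k is j.+1 then scale_ideal f%:R (ideal_exp D P j) else order_of_conductor D f.

Section Order.
Context (D P P' : set algC) (f : nat).
Hypothesis sp : split_prime D P P' f.

Let pf := split_prime_nat sp.
Let rD := split_ring sp.
Let iP := split_ideall sp.
Let O := order_of_conductor D f.
Let F := scale_ideal f%:R D.
Let rO : is_subring O := order_subring f rD.
Let OD : O `<=` D := order_sub rD.
Let FO : F `<=` O := @order_conductor D f.
Let iF : is_ideal D F := conductor_ideal f rD.
Let f0 := split_natr_neq0 sp.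
Let iPn n : is_ideal D (ideal_exp D P n) := split_exp_ideal sp n.

Lemma basic_chain_sub k : basic_chain D P f k.+1 `<=` F.
Proof. by apply: scale_idealS => x; apply: (ideal_sub (iPn k)). Qed.

Lemma basic_chain_ideal k : is_ideal O (basic_chain D P f k).
Proof.
case: k => [|k]; first exact: subring_ideal.
apply: (ideal_restrict OD); first by move=> x /basic_chain_sub/FO.
exact: (scale_ideal_ideal (subring_nat _ rD) rD (iPn k)).
Qed.

Lemma basic_chain_decr i j : (i <= j)%N -> basic_chain D P f j `<=` basic_chain D P f i.
Proof.
case: i j => [|i] [|j] leij; [by move=> x | by move=> x /basic_chain_sub/FO | by [] |].
by apply: scale_idealS; apply: (split_exp_decr sp (leij : (i <= j)%N)).
Qed.

Lemma basic_chain_f k : basic_chain D P f k (f%:R ^+ k).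
Proof.
case: k => [|k]; first exact: (subring1 rO).
by exists (f%:R ^+ k); [apply: (split_exp_f sp k) | rewrite exprS].
Qed.

Lemma basic_chain_int k (c : int) : basic_chain D P f k c%:~R -> ((f ^ k)%N %| c)%Z.
Proof.
case: k => [|k]; first by rewrite expn0 dvd1z.
move=> Rc; have [x Dx xE] := basic_chain_sub Rc.
have /dvdzP[e cE] : (f %| c)%Z.
  by apply: (split_int sp); rewrite -xE; apply: (idealMr iP Dx (split_fl sp)).
move: Rc; rewrite cE intrM mulrC => /(scale_ideal_cancel f0)/(split_exp_int sp).
by rewrite expnS PoszM mulrC; apply: dvdz_mul.
Qed.

Lemma basic_chain_res k x : O x -> exists c : int, basic_chain D P f k (x - c%:~R).
Proof.
case: k => [|k] Ox; first by exists 0; rewrite subr0.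
have [c [y Dy yE]] := Ox; have [e Pe] := split_exp_res sp k Dy.
exists (c + f%:Z * e); exists (y - e%:~R) => //.
by rewrite mulrBr yE intrD intrM -pmulrn; ring.
Qed.

Lemma over_basic_chain k Q : is_ideal O Q -> basic_chain D P f k `<=` Q ->
  exists2 i, (i <= k)%N & Q = basic_chain D P f i.
Proof.
apply: (chain_of_ideals pf rO) => [|i j|n|n c|n x].
- exact: basic_chain_ideal.
- exact: basic_chain_decr.
- exact: basic_chain_f.
- exact: basic_chain_int.
exact: basic_chain_res.
Qed.

(** The least power of f in an ideal of the chain recovers its index. *)
Lemma basic_chain_le i j : basic_chain D P f i = basic_chain D P f j -> (j <= i)%N.
Proof.
move=> eqR; have := basic_chain_f i; rewrite eqR -natrX.
move=> /(@basic_chain_int j (f ^ i)%N); rewrite dvdzE /=.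
by rewrite dvdn_Pexp2l // prime_gt1.
Qed.

(** Let x = c + f y with c an integer; the point is that f divides c. With p in
    P and 1 - p in P', the product c p is an integer e up to f D. Reducing mod
    P gives f | e, and then reducing mod P' gives f | c. *)
Lemma order_colon x : O x -> scale_ideal x D `<=` O -> F x.
Proof.
move=> [c [y Dy yE]] xDO; have [p Pp P'p] := split_comax sp.
have Dp := ideal_sub iP Pp.
have iP' := split_idealr sp.
have P'F z : F z -> P' z.
  by move=> [w Dw <-]; apply: (idealMr iP' Dw (split_fl (split_sym sp))).
have [e [z Dz zE]] : O (x * p) by apply: xDO; exists p.
have Fe : F (c%:~R * p - e%:~R).
  exists (z - y * p); first exact: (subringB rD Dz (subringM rD Dy Dp)).
  by rewrite mulrBr zE mulrA yE; ring.
have /dvdzP[h eE] : (f %| e)%Z.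
  apply: (split_int sp).
  have -> : e%:~R = c%:~R * p - (c%:~R * p - e%:~R) by ring.
  apply: (idealB rD iP (idealMl iP (subring_int _ rD) Pp) _).
  by have [w Dw <-] := Fe; apply: (idealMr iP Dw (split_fl sp)).
have /dvdzP[g cE] : (f %| c)%Z.
  apply: (split_int (split_sym sp)).
  have -> : c%:~R = c%:~R * (1 - p) + (c%:~R * p - e%:~R) + h%:~R * f%:R.
    by rewrite eE intrM; ring.
  apply: (idealD iP'); last first.
    exact: (idealMl iP' (subring_int _ rD) (split_fl (split_sym sp))).
  apply: (idealD iP'); first exact: (idealMl iP' (subring_int _ rD) P'p).
  exact: P'F.
exists (y + g%:~R); first exact: (subringD rD Dy (subring_int _ rD)).
by rewrite mulrDr yE cE intrM; ring.
Qed.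

Lemma conductor_gen_colon : [set x | O x /\ scale_ideal x D `<=` O] = F.
Proof.
apply/seteqP; split=> x; first by case; apply: order_colon.
move=> Fx; split; first exact: FO.
by move=> _ [y Dy <-]; apply/FO/(idealMr iF Dy Fx).
Qed.

(** An element x of Q outside f D satisfies u x = 1 mod f D for some integer u;
    a geometric series turns this into a multiple of x that is 1 mod
    f^(n+1) D, and f^(n+1) D lies in f^n O. *)
Lemma ideal_unit Q n : is_ideal O Q -> Q (f%:R ^+ n) -> ~ Q `<=` F -> Q = O.
Proof.
move=> iQ Qn NQF; apply: (ideal1 iQ).
have [x [Qx NFx]] := nonsubset NQF.
have [c Fxc] := ideal_sub iQ Qx.
have Nfc : ~~ (f %| c)%Z.
  apply/negP => /dvdzP[e cE]; apply: NFx; rewrite -(subrK c%:~R x).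
  apply: (idealD iF Fxc _); exists e%:~R; first exact: (subring_int _ rD).
  by rewrite cE intrM mulrC.
have [u [v uv]] := prime_Bezout pf Nfc.
set y := 1 - u%:~R * x.
have [z Dz zE] : F y.
  have -> : y = - (u%:~R * (x - c%:~R) + f%:R * v%:~R).
    by rewrite /y mulrBr uv; ring.
  rewrite -mulN1r; apply: (idealMl iF (subringN rD (subring1 rD)) _).
  apply: (idealD iF); first exact: (idealMl iF (subring_int _ rD) Fxc).
  by exists v%:~R => //; exact: (subring_int v rD).
have Oy : O y by apply: FO; exists z.
have -> : 1 = f%:R ^+ n * (f%:R * z ^+ n.+1) + (\sum_(i < n.+1) y ^+ i) * u%:~R * x.
  have := subrX1 y n.+1; set s := \sum_(i < _) _ => E.
  have -> : f%:R ^+ n * (f%:R * z ^+ n.+1) = y ^+ n.+1.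
    by rewrite -zE exprMn (exprSr f%:R) mulrA.
  have -> : y ^+ n.+1 = (y - 1) * s + 1 by rewrite -E subrK.
  by rewrite /y; ring.
apply: (idealD iQ).
  apply: (idealMr iQ) => //; apply: FO; exists (z ^+ n.+1) => //.
  exact: (subringX _ rD Dz).
apply: (idealMl iQ _ Qx); apply: (subringM rO _ (subring_int _ rO)).
by apply: (@subring_sum _ _ (fun i => y ^+ i)) => // i; apply: subringX.
Qed.

(** The ideal Q D is f times an ideal of D not inside f D, hence f times a
    power of P or of P'; and f Q D lies in Q because f D lies in O. *)
Lemma basic_ideal_sandwich Q n : is_ideal O Q -> Q `<=` F -> Q (f%:R ^+ n) ->
    ~ Q `<=` scale_ideal f%:R F ->
  exists a, exists2 R, R = ideal_exp D P a \/ R = ideal_exp D P' a &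
    scale_ideal f%:R (scale_ideal f%:R R) `<` Q /\ Q `<=` scale_ideal f%:R R.
Proof.
move=> iQ QF Qn NQff.
have QD : Q `<=` D by move=> x Qx; apply/OD/(ideal_sub iQ Qx).
pose QDn : set algC := ideal_mul Q D.
have iQD : is_ideal D QDn by apply: (ideal_mul_ideal rD QD (subring_ideal rD)).
pose I : set algC := [set x | D x /\ QDn (f%:R * x)].
have iI : is_ideal D I.
  split=> [x []//||x y [Dx Qx] [Dy Qy]|a x Da [Dx Qx]].
  - by split; [apply: (subring0 rD) | rewrite mulr0; apply: (ideal0 iQD)].
  - by split; [apply: (subringD) | rewrite mulrDr; apply: (idealD iQD Qx Qy)].
  by split; [apply: subringM | rewrite mulrCA; apply: (idealMl iQD Da Qx)].
have QI : Q `<=` scale_ideal f%:R I.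
  move=> x Qx; have [y Dy yE] := QF x Qx; exists y => //; split=> //.
  by rewrite yE -[x]mulr1; apply: ideal_mul_mem => //; exact: (subring1 rD).
have fIQ : scale_ideal f%:R (scale_ideal f%:R I) `<=` Q.
  move=> _ [_ [x [_ Qx] <-] <-]; move: (f%:R * x) Qx.
  apply: ideal_mul_sub => [|x1 x2|x1 x2 Qx1 Dx2].
  - by rewrite mulr0; apply: (ideal0 iQ).
  - by rewrite mulrDr; apply: (idealD iQ).
  by rewrite mulrCA; apply: (idealMr iQ _ Qx1); apply: FO; exists x2.
have IF : ~ I `<=` F by move=> IF; apply: NQff => x /QI; apply: scale_idealS.
have In : I (f%:R ^+ n).
  split; first exact: (subringX _ rD (subring_nat _ rD)).
  by rewrite mulrC; apply: ideal_mul_mem => //; exact: (subring_nat f rD).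
have [a IE] := split_ideal_classify sp iI In IF; exists a, I => //; split=> //.
split=> // Qff; apply: NQff => x /Qff; do 2!apply: scale_idealS.
by move=> y [].
Qed.

(** Let x in Q lie outside t O, and let j be least with y = f^j x / t in D. Then
    y is not in O. Indeed, let y = c + f z with c an integer. For j = 0, x
    would be in t O; for j > 0 and f | c, f^(j-1) x / t would be in D; for j > 0
    and f prime to c, the equality t c = f^j x - f t z would put t in f^2 D. As
    D/O has prime order, O + O y = D, and so Q contains t D. *)
Lemma principal_or_over Q t n : is_ideal O Q -> Q `<=` F -> Q t ->
    ~ scale_ideal f%:R F t -> scale_ideal t O (f%:R ^+ n) ->
  Q = scale_ideal t O \/ scale_ideal t D `<=` Q.
Proof.
move=> iQ QF Qt Nfft tn.
have [sub|NQt] := pselect (Q `<=` scale_ideal t O); [left | right].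
  by apply/seteqP; split=> // _ [a Oa <-]; apply: (idealMr iQ Oa Qt).
have [x [Qx Ntx]] := nonsubset NQt.
have exD : exists j, `[< exists2 y, D y & f%:R ^+ j * x = t * y >].
  exists n; apply/asboolP; have [a Oa <-] := tn.
  exists (a * x); last by rewrite mulrA.
  by apply: (subringM rD (OD Oa) _); apply/OD/(ideal_sub iQ Qx).
case: (ex_minnP exD) => j /asboolP[y Dy jE] jmin.
have Qy : Q (t * y).
  by rewrite -jE; apply: (idealMl iQ _ Qx); exact: (subringX j rO (subring_nat f rO)).
have NOy : ~ O y.
  move=> Oy; case: j jE jmin => [|j] jE jmin.
    by apply: Ntx; exists y; rewrite // -jE expr0 mul1r.
  have [c [z Dz zE]] := Oy.
  have [fc|Nfc] := boolP (f %| c)%Z.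
    have /dvdzP[e cE] := fc.
    suff /jmin : `[< exists2 y, D y & f%:R ^+ j * x = t * y >] by rewrite ltnn.
    apply/asboolP; exists (z + e%:~R); first exact: (subringD rD Dz (subring_int _ rD)).
    apply: (mulfI f0); rewrite mulrA -exprS jE -(subrK c%:~R y) -zE cE intrM.
    by ring.
  have [u [v uv]] := prime_Bezout pf Nfc; apply: Nfft.
  have iFF := scale_ideal_ideal (subring_nat f rD) rD iF.
  have FFc : scale_ideal f%:R F (t * c%:~R).
    have -> : t * c%:~R = f%:R ^+ j.+1 * x - f%:R * (t * z).
      by rewrite jE -{1}(subrK c%:~R y) -zE; ring.
    apply: (idealB rD iFF).
      exists (f%:R ^+ j * x); last by rewrite exprS mulrA.
      by apply: (idealMl iF _ (QF _ Qx)); exact: (subringX j rD (subring_nat f rD)).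
    by exists (t * z) => //; apply: (idealMr iF Dz (QF _ Qt)).
  have -> : t = u%:~R * (t * c%:~R) - f%:R * (t * v%:~R).
    by rewrite mulrCA uv; ring.
  apply: (idealB rD iFF); first exact: (idealMl iFF (subring_int _ rD) FFc).
  by exists (t * v%:~R) => //; apply: (idealMr iF (subring_int _ rD) (QF _ Qt)).
(* y generates D over O: an integer combination of 1 and y has any prescribed
   residues mod P and mod P'. *)
move=> _ [w Dw <-].
have [b Pb] := split_resl sp Dy.
have NP'b : ~ P' (y - b%:~R).
  move=> P'b; apply: NOy; exists b; exact: (split_cap sp Pb P'b).
have [u P'u] := split_inv (split_sym sp) (subringB rD Dy (subring_int b rD)) NP'b.
have [e Pe] := split_resl sp Dw.
have [g P'g] := split_resr sp (subringB rD Dw (subring_int e rD)).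
have Fw : F (w - e%:~R - (g * u)%:~R * (y - b%:~R)).
  have iP' := split_idealr sp; apply: (split_cap sp).
    exact: (idealB rD iP Pe (idealMl iP (subring_int _ rD) Pb)).
  have -> : w - e%:~R - (g * u)%:~R * (y - b%:~R)
      = (w - e%:~R - g%:~R) - g%:~R * (u%:~R * (y - b%:~R) - 1).
    by rewrite intrM; ring.
  exact: (idealB rD iP' P'g (idealMl iP' (subring_int _ rD) P'u)).
have -> : t * w = t * (w - e%:~R - (g * u)%:~R * (y - b%:~R))
    + t * (e - g * u * b)%:~R + (g * u)%:~R * (t * y).
  by rewrite intrB !intrM; ring.
apply: (idealD iQ); last exact: (idealMl iQ (subring_int _ rO) Qy).
apply: (idealD iQ); apply: (idealMr iQ _ Qt); first exact: FO.
exact: (subring_int _ rO).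
Qed.

End Order.

(** With t = f s, the ideal s D is a power of P or of P', so t D is a member of
    the chain of P or of P', and Q contains it unless Q is O or t O, which are
    principal. *)
Lemma over_basic_elt D P P' f Q t n (O := order_of_conductor D f)
    (F := scale_ideal f%:R D) : split_prime D P P' f -> is_ideal O Q -> Q t -> F t ->
    ~ scale_ideal f%:R F t -> scale_ideal t O (f%:R ^+ n) -> ~ is_principal O Q ->
  exists k, Q = basic_chain D P f k \/ Q = basic_chain D P' f k.
Proof.
move=> sp iQ Qt Ft Nfft tn NprQ.
have rD := split_ring sp; have rO : is_subring O := order_subring f rD.
have OD : O `<=` D := order_sub rD.
have Qn : Q (f%:R ^+ n) by case: tn => a Oa <-; apply: (idealMr iQ Oa Qt).
have QF : Q `<=` F.
  apply: contrapT => /(ideal_unit sp iQ Qn) QO; apply: NprQ.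
  exists 1; first exact: (subring1 rO).
  rewrite QO; apply/seteqP; split=> [x Ox|_ [x Ox <-]]; last by rewrite mul1r.
  by exists x; rewrite ?mul1r.
have [QE|tDQ] := principal_or_over sp iQ QF Qt Nfft tn.
  by case: NprQ; exists t => //; apply: (ideal_sub iQ Qt).
have [s Ds sE] := Ft.
have iI := scale_ideal_ideal Ds rD (subring_ideal rD).
have In : scale_ideal s D (f%:R ^+ n).
  have [a Oa <-] := tn; exists (f%:R * a); last by rewrite -sE; ring.
  exact: (subringM rD (subring_nat _ rD) (OD _ Oa)).
have NIF : ~ scale_ideal s D `<=` F.
  move=> sF; apply: Nfft; exists s => //; apply: sF.
  by exists 1; [apply: (subring1 rD) | rewrite mulr1].
have tDE : scale_ideal f%:R (scale_ideal s D) `<=` Q.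
  by move=> _ [_ [x Dx <-] <-]; apply: tDQ; exists x; rewrite // -sE mulrA.
have [a []E] := split_ideal_classify sp iI In NIF; move: tDE; rewrite E.
  by move/(@over_basic_chain _ _ _ _ sp a.+1 _ iQ)=> [i _ ->]; exists i; left.
by move/(@over_basic_chain _ _ _ _ (split_sym sp) a.+1 _ iQ)=> [i _ ->]; exists i; right.
Qed.


(** * Two generators for the ideals of the chain *)

(** Each block of m factors P is traded for one factor beta. *)
Lemma exp_principal_sub D P m beta k : is_subring D -> is_ideal D P ->
  ideal_exp D P m = scale_ideal beta D ->
  ideal_exp D P (k * m) `<=` scale_ideal (beta ^+ k) D.
Proof.
move=> rD iP PmE.
have iPn n : is_ideal D (ideal_exp D P n).
  by apply: ideal_exp_ideal => // x; apply: (ideal_sub iP).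
have Dbeta : D beta.
  apply: (ideal_sub (iPn m)); rewrite PmE; exists 1; last by rewrite mulr1.
  exact: (subring1 rD).
have shift n : ideal_exp D P (n + m) `<=` scale_ideal beta (ideal_exp D P n).
  have iS l := scale_ideal_ideal Dbeta rD (iPn l).
  elim: n => [|n IHn]; first by rewrite add0n PmE.
  rewrite addSn; apply: ideal_mul_sub => [|x y|x y Px /IHn[z Pz <-]].
  - exact: (ideal0 (iS n.+1)).
  - exact: (idealD (iS n.+1)).
  by exists (x * z); [apply: ideal_mul_mem | rewrite mulrCA].
elim: k => [|k IHk] x; first by move=> Dx; exists x; rewrite // expr0 mul1r.
rewrite mulSn addnC => /shift[_ /IHk[y Dy <-] <-].
by exists y; rewrite // exprS mulrA.
Qed.

(** For k = j + 1 both sides are divisible by f, and the claim becomes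
    P^j = f^j O + beta^k O. An x in P^j is an integer, necessarily divisible
    by f^j, plus an element beta^k y of P^(mk). Here y is an integer plus an
    element of P'^k, and beta^k P'^k lies in f^k D, hence in f^j O. *)
Lemma basic_chain_gen D P P' f m beta k : split_prime D P P' f -> (0 < m)%N ->
  ideal_exp D P m = scale_ideal beta D ->
  ideal2 (order_of_conductor D f) (f%:R ^+ k) (tk f beta k) = basic_chain D P f k.
Proof.
move=> sp m0 PmE; have rD := split_ring sp; have iP := split_ideall sp.
have rO : is_subring (order_of_conductor D f) := order_subring f rD.
have iR := basic_chain_ideal sp k.
have Pbeta : P beta.
  apply: (split_exp1 sp); apply: (split_exp_decr sp m0); rewrite PmE.
  by exists 1; [apply: (subring1 rD) | rewrite mulr1].
have Dbeta := ideal_sub iP Pbeta.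
have Rt : basic_chain D P f k (tk f beta k).
  case: k {iR} => [|k]; last first.
    by exists (beta ^+ k.+1) => //; apply: (split_expS sp); apply: (split_expX sp).
  by rewrite /tk expr0 mulr1; apply: (subring_nat f rO).
apply/seteqP; split.
  move=> _ [_ [a Oa <-] [_ [b Ob <-] <-]]; apply: (idealD iR).
    exact: (idealMr iR Oa (basic_chain_f sp k)).
  exact: (idealMr iR Ob Rt).
case: k {iR Rt} => [|k] x.
  move=> Ox; exists x; first by exists x; rewrite // expr0 mul1r.
  by exists 0; [exists 0; [apply: (subring0 rO) | rewrite mulr0] | rewrite addr0].
case=> y Py <-.
have [c Pc] := split_exp_res sp (k.+1 * m) (ideal_sub (split_exp_ideal sp k) Py).
have [z Dz zE] := exp_principal_sub rD iP PmE Pc.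
have Pkc : ideal_exp D P k c%:~R.
  have -> : c%:~R = y - (y - c%:~R) by ring.
  apply: (idealB rD (split_exp_ideal sp k) Py); apply: (split_exp_decr sp _ Pc).
  by rewrite (leq_trans (leqnSn k)) // leq_pmulr.
have /dvdzP[e cE] := split_exp_int sp Pkc.
have [h P'h] := split_exp_res (split_sym sp) k.+1 Dz.
have [w Dw wE] : scale_ideal (f%:R ^+ k.+1) D (beta ^+ k.+1 * (z - h%:~R)).
  rewrite mulrC; exact: (split_exp_mulX (split_sym sp) P'h Pbeta).
have fk : (f ^ k)%N%:~R = f%:R ^+ k :> algC by rewrite -natrX.
exists (f%:R ^+ k.+1 * (e%:~R + f%:R * w)).
  exists (e%:~R + f%:R * w) => //; exists e; exists w => //; ring.
exists (tk f beta k.+1 * h%:~R).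
  by exists h%:~R => //; apply: (subring_int h rO).
rewrite mulrDr [_ * (f%:R * w)]mulrCA wE /tk -(subrK c%:~R y) -zE cE intrM fk exprS.
by ring.
Qed.

(** * Quadratic orders *)

Lemma Zadjoin_subring (x : algC) : is_subring (Zadjoin x).
Proof.
split.
- by exists 1; rewrite ?rmorph1 ?hornerC.
- by move=> _ _ [p _ <-] [q _ <-]; exists (p - q); rewrite // rmorphB hornerD hornerN.
by move=> _ _ [p _ <-] [q _ <-]; exists (p * q); rewrite // rmorphM hornerM.
Qed.

Lemma Zadjoin_gen (x : algC) : Zadjoin x x.
Proof. by exists 'X; rewrite // map_polyX hornerX. Qed.

Lemma Zadjoin_quadratic (x : algC) (r s : int) : x ^+ 2 = r%:~R * x + s%:~R ->
  Zadjoin x = [set y | exists a b : int, y = a%:~R + b%:~R * x].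
Proof.
move=> xx; have rZ := Zadjoin_subring x; apply/seteqP; split=> y; last first.
  move=> [a [b ->]]; apply: (subringD rZ (subring_int _ rZ)).
  exact: (subringM rZ (subring_int _ rZ) (Zadjoin_gen x)).
case=> p _ <-; elim/poly_ind: p => [|p c [a [b pE]]].
  by exists 0, 0; rewrite rmorph0 horner0 mul0r addr0.
exists (c + b * s), (a + b * r).
rewrite rmorphD rmorphM /= map_polyX map_polyC /= hornerD hornerM hornerX hornerC pE.
rewrite mulrDl -mulrA -expr2 xx !intrD !intrM; ring.
Qed.

(** As P is not inside f D, it contains some a + b w that is not divisible by f.
    If f divided b, then P would contain both f and a, with a prime to f, hence
    1; so b is invertible mod f and w is congruent to an integer mod P. *)
Lemma residues_of_generator (D P : set algC) (f : nat) (w : algC) :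
    prime f -> is_subring D -> D w ->
    (forall x, D x -> exists a b : int, x = a%:~R + b%:~R * w) ->
    is_ideal D P -> ~ P 1 -> P f%:R -> ~ P `<=` scale_ideal f%:R D ->
  forall x, D x -> exists c : int, P (x - c%:~R).
Proof.
move=> pf rD Dw Dgen iP P1 Pf NPF.
have [x [Px NFx]] := nonsubset NPF.
have [a [b xE]] := Dgen x (ideal_sub iP Px).
have Pfz z : D z -> P (z * f%:R) by move=> Dz; apply: (idealMl iP Dz Pf).
have Nfb : ~~ (f %| b)%Z.
  apply/negP => /dvdzP[b' bE].
  have Pa : P a%:~R.
    have -> : a%:~R = x - b'%:~R * w * f%:R by rewrite xE bE intrM; ring.
    by apply: (idealB rD iP Px); apply: Pfz; apply: (subringM rD (subring_int _ rD) Dw).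
  have [/dvdzP[a' aE]|Nfa] := boolP (f %| a)%Z.
    apply: NFx; exists (a'%:~R + b'%:~R * w); last by rewrite xE aE bE !intrM; ring.
    apply: (subringD rD (subring_int _ rD)).
    exact: (subringM rD (subring_int _ rD) Dw).
  have [u [v uv]] := prime_Bezout pf Nfa; apply: P1.
  have -> : 1 = u%:~R * a%:~R - v%:~R * f%:R :> algC by rewrite uv addrK.
  apply: (idealB rD iP (idealMl iP (subring_int _ rD) Pa)).
  by apply: Pfz; apply: (subring_int _ rD).
have [u [v uv]] := prime_Bezout pf Nfb.
move=> y /Dgen[h [g ->]]; exists (h - g * u * a).
have -> : h%:~R + g%:~R * w - (h - g * u * a)%:~R
    = (g * u)%:~R * x - g%:~R * v%:~R * w * f%:R.
  have -> : g%:~R * v%:~R * w * f%:R = g%:~R * w * (u%:~R * b%:~R - 1).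
    by rewrite uv; ring.
  by rewrite xE intrB !intrM; ring.
apply: (idealB rD iP (idealMl iP (subring_int _ rD) Px)).
apply: Pfz; apply: (subringM rD _ Dw).
exact: (subringM rD (subring_int _ rD) (subring_int _ rD)).
Qed.

(** P is not inside f D: otherwise f D = P P' would lie in f P', whence 1 would
    be in P'. As the residue fields are those of the integers mod f, any element
    of one of the two ideals outside the other yields comaximality. *)
Lemma split_prime_of_factorization (D P P' : set algC) (f : nat) (w : algC) :
    prime f -> is_subring D -> D w ->
    (forall x, D x -> exists a b : int, x = a%:~R + b%:~R * w) ->
    is_prime_ideal D P -> is_prime_ideal D P' -> P <> P' ->
    scale_ideal f%:R D = ideal_mul P P' ->
  split_prime D P P' f.
Proof.
move=> pf rD Dw Dgen [iP PD _] [iP' P'D _] PP' mulE.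
have f0 : f%:R != 0 :> algC by rewrite pnatr_eq0 -lt0n prime_gt0.
have Ff : scale_ideal f%:R D f%:R by exists 1; [apply: (subring1 rD) | rewrite mulr1].
have key I J : is_ideal D I -> I <> D -> is_ideal D J -> J <> D ->
    scale_ideal f%:R D = ideal_mul I J ->
  [/\ ~ I 1, I f%:R & forall x, D x -> exists c : int, I (x - c%:~R)].
  move=> iI ID iJ JD IJE.
  have I1 : ~ I 1 by move/(ideal1 iI).
  have If : I f%:R.
    move: Ff; rewrite IJE; apply: ideal_mul_sub => [|x y|x y Ix Jy].
    - exact: (ideal0 iI).
    - exact: (idealD iI).
    exact: (idealMr iI (ideal_sub iJ Jy) Ix).
  split=> //; apply: (residues_of_generator pf rD Dw Dgen iI I1 If) => IF.
  apply: JD; apply: (ideal1 iJ); apply: (scale_ideal_cancel f0); rewrite mulr1.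
  have iS := scale_ideal_ideal (subring_nat f rD) rD iJ.
  move: Ff; rewrite IJE; apply: ideal_mul_sub => [|x y|x y /IF[z Dz <-] Jy].
  - exact: (ideal0 iS).
  - exact: (idealD iS).
  by exists (z * y); [apply: (idealMl iJ Dz Jy) | rewrite mulrA].
have [P1 Pf resP] := key _ _ iP PD iP' P'D mulE.
have [P'1 P'f resP'] := key _ _ iP' P'D iP PD (etrans mulE (ideal_mulC _ _)).
split=> //.
have [sub|NPsub] := pselect (P `<=` P').
  have NP'sub : ~ P' `<=` P by move=> sub'; apply: PP'; apply/seteqP; split.
  have [x [P'x NPx]] := nonsubset NP'sub.
  have [u Pu] := residue_inv pf rD iP Pf resP (ideal_sub iP' P'x) NPx.
  exists (1 - u%:~R * x); last first.
    by rewrite opprB addrC subrK; apply: (idealMl iP' (subring_int _ rD) P'x).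
  by rewrite -opprB -mulN1r; apply: (idealMl iP _ Pu); apply: (subringN rD (subring1 rD)).
have [x [Px NP'x]] := nonsubset NPsub.
have [u P'u] := residue_inv pf rD iP' P'f resP' (ideal_sub iP Px) NP'x.
exists (u%:~R * x); first exact: (idealMl iP (subring_int _ rD) Px).
by rewrite -opprB -mulN1r; apply: (idealMl iP' _ P'u); apply: (subringN rD (subring1 rD)).
Qed.

Lemma quad_order_conductor (d : int) (f : nat) (r s : int) :
  quad_omega d ^+ 2 = r%:~R * quad_omega d + s%:~R ->
  quad_order d f = order_of_conductor (quad_maxorder d) f.
Proof.
move=> ww; set w := quad_omega d in ww *.
have fww : (f%:R * w) ^+ 2 = (f%:Z * r)%:~R * (f%:R * w) + (f%:Z * f%:Z * s)%:~R.
  by rewrite exprMn ww !intrM -pmulrn; ring.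
rewrite /quad_order /quad_maxorder (Zadjoin_quadratic fww) (Zadjoin_quadratic ww).
apply/seteqP; split=> x.
  move=> [a [b ->]]; exists a; exists (b%:~R * w); last by ring.
  by exists 0, b; rewrite add0r.
move=> [c [_ [a [b ->]] xE]]; exists (c + f%:Z * a), b.
by rewrite -(subrK c%:~R x) -xE intrD intrM -pmulrn; ring.
Qed.

(** * Conjugation *)

(** The graph of the conjugation of Q(sqrt d), which is defined on this subfield
    of the algebraic numbers only. Additivity and multiplicativity hold without
    any condition on d; only uniqueness of the conjugate needs sqrt d to be
    irrational. *)
Definition conj_rel (d : int) (y x : algC) : Prop :=
  exists a b : rat, y = ratr a + ratr b * sqrtz d /\ x = ratr a - ratr b * sqrtz d.

Lemma conj_idealE d I : conj_ideal d I = [set x | exists2 y, I y & conj_rel d y x].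
Proof.
apply/seteqP; split=> x.
  by move=> [a [b [Iy ->]]]; exists (ratr a + ratr b * sqrtz d) => //; exists a, b.
by move=> [y Iy [a [b [yE ->]]]]; exists a, b; rewrite -yE.
Qed.

Lemma sqrtz_sq d : sqrtz d ^+ 2 = d%:~R.
Proof. exact: sqrtCK. Qed.

Lemma conj_rel_int d (c : int) : conj_rel d c%:~R c%:~R.
Proof. by exists c%:~R, 0; rewrite ratr_int rmorph0 mul0r addr0 subr0. Qed.

Lemma conj_rel_sym d x y : conj_rel d x y -> conj_rel d y x.
Proof. by move=> [a [b [-> ->]]]; exists a, (- b); rewrite rmorphN mulNr opprK. Qed.

Lemma conj_relD d x y x' y' :
  conj_rel d x x' -> conj_rel d y y' -> conj_rel d (x + y) (x' + y').
Proof.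
move=> [a [b [-> ->]]] [a' [b' [-> ->]]]; exists (a + a'), (b + b').
by rewrite !rmorphD /=; split; ring.
Qed.

Lemma conj_relM d x y x' y' :
  conj_rel d x x' -> conj_rel d y y' -> conj_rel d (x * y) (x' * y').
Proof.
move=> [a [b [-> ->]]] [a' [b' [-> ->]]].
exists (a * a' + b * b' * d%:~R), (a * b' + a' * b).
rewrite !rmorphD !rmorphM /= ratr_int -sqrtz_sq.
by split; ring.
Qed.

(** A rational square root of an integer is an integer, and a square that is
    square-free is 1. *)
Lemma squarefree_sqrt_irrational d (q : rat) : squarefreez d -> d <> 1 -> q ^+ 2 <> d%:~R.
Proof.
move=> sqf d1 qE.
have q0 : (denq q)%:~R != 0 :> rat by rewrite intr_eq0 denq_neq0.
have numE : numq q ^+ 2 = d * denq q ^+ 2.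
  apply: (@intr_inj rat); rewrite !expr2 !intrM -qE -[X in X ^+ 2]divq_num_den.
  by field.
have den1 : denq q = 1.
  have co := coprime_num_den q.
  have : (`|denq q| %| `|numq q|)%N.
    rewrite -(Gauss_dvdr (n := `|numq q|)) 1?coprime_sym //.
    have := congr1 absz numE; rewrite !expr2 !abszM => ->.
    by rewrite !dvdn_mull.
  move/gcdn_idPr; rewrite (eqP co) => E.
  by rewrite -absz_denq -E.
move: numE; rewrite den1 expr1n mulr1 => dE.
have := sqf (numq q); rewrite dE dvdzz => /(_ isT).
by move=> U; apply: d1; rewrite -dE; case/orP: U => /eqP->.
Qed.

Lemma conj_rel_inj d x y y' : squarefreez d -> d <> 1 ->
  conj_rel d x y -> conj_rel d x y' -> y = y'.
Proof.
move=> sqf d1 [a [b [-> ->]]] [a' [b' [E ->]]].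
have [bb|Nbb] := eqVneq b b'; first by move: E; rewrite bb => /addIr ->.
case: (@squarefree_sqrt_irrational d ((a' - a) / (b - b')) sqf d1).
have b0 : ratr (b - b') != 0 :> algC by rewrite fmorph_eq0 subr_eq0.
apply: (@fmorph_inj _ _ (@ratr algC)); rewrite rmorphXn fmorph_div /= ratr_int -sqrtz_sq.
congr (_ ^+ 2); apply: (canLR (mulfK b0)); rewrite !rmorphB /=.
apply/eqP; rewrite -subr_eq0; apply/eqP.
have -> : 0 = ratr a' + ratr b' * sqrtz d - (ratr a + ratr b * sqrtz d).
  by rewrite E subrr.
by ring.
Qed.

Lemma conj_ideal_mul d I J : squarefreez d -> d <> 1 ->
    (forall x, I x -> exists y, conj_rel d x y) ->
    (forall x, J x -> exists y, conj_rel d x y) ->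
  conj_ideal d (ideal_mul I J) = ideal_mul (conj_ideal d I) (conj_ideal d J).
Proof.
move=> sqf d1 IK JK; rewrite !conj_idealE; apply/seteqP; split.
  move=> x [y IJy yx].
  set IJ' := ideal_mul _ _.
  suff [x' IJx' yx'] : exists2 x', IJ' x' & conj_rel d y x'.
    by rewrite (conj_rel_inj sqf d1 yx yx').
  move: y IJy {yx}; apply: ideal_mul_sub.
  - by exists 0; [apply: ideal_mul0 | apply: (conj_rel_int d 0)].
  - move=> y z [y' Iy' yy'] [z' Iz' zz']; exists (y' + z'); first exact: ideal_mulD.
    exact: conj_relD.
  move=> y z Iy Jz; have [y' yy'] := IK y Iy; have [z' zz'] := JK z Jz.
  by exists (y' * z'); [apply: ideal_mul_mem; [exists y | exists z] | apply: conj_relM].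
apply: ideal_mul_sub.
- by exists 0; [apply: ideal_mul0 | apply: (conj_rel_int d 0)].
- move=> y z [y' Iy' yy'] [z' Iz' zz']; exists (y' + z'); first exact: ideal_mulD.
  exact: conj_relD.
move=> y z [y' Iy' yy'] [z' Iz' zz'].
by exists (y' * z'); [apply: ideal_mul_mem | apply: conj_relM].
Qed.

Lemma conj_ideal_scale d n I : squarefreez d -> d <> 1 ->
    (forall x, I x -> exists y, conj_rel d x y) ->
  conj_ideal d (scale_ideal n%:R I) = scale_ideal n%:R (conj_ideal d I).
Proof.
move=> sqf d1 IK; rewrite !conj_idealE.
have nn : conj_rel d n%:R n%:R := conj_rel_int d n.
apply/seteqP; split=> x.
  move=> [_ [y Iy <-] yx]; have [z yz] := IK y Iy; exists z; first by exists y.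
  exact: (conj_rel_inj sqf d1 (conj_relM nn yz) yx).
move=> [z [y Iy yz] <-]; exists (n%:R * y); last exact: conj_relM.
by exists y.
Qed.

Lemma conj_ideal_exp d D P n : squarefreez d -> d <> 1 -> is_subring D -> is_ideal D P ->
    (forall x, D x -> exists y, conj_rel d x y) -> conj_ideal d D = D ->
  conj_ideal d (ideal_exp D P n) = ideal_exp D (conj_ideal d P) n.
Proof.
move=> sqf d1 rD iP DK cD; elim: n => //= n IHn.
rewrite conj_ideal_mul // ?IHn // => x; first by move/(ideal_sub iP)/DK.
by move/(ideal_sub (ideal_exp_ideal n rD (fun x => ideal_sub iP)))/DK.
Qed.

(** r and -s are the trace and the norm of omega. *)
Lemma quad_omega_quadratic d : exists r s : int,
  quad_omega d ^+ 2 = r%:~R * quad_omega d + s%:~R /\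
  conj_rel d (quad_omega d) (r%:~R - quad_omega d).
Proof.
rewrite /quad_omega; case: ifP => [|_].
  rewrite eqz_mod_dvd => /dvdzP[e dE]; exists 1, e; split.
    have := sqrtz_sq d; rewrite -(subrK 1 d) dE intrD intrM => E.
    by rewrite expr_div_n sqrrD E; field.
  exists (1 / 2), (1 / 2); rewrite fmorph_div rmorph1 rmorph_nat.
  by split; field.
exists 0, d; rewrite sqrtz_sq mul0r !add0r; split=> //.
by exists 0, 1; rewrite rmorph0 rmorph1 !mul1r !add0r.
Qed.

(** * F-basic ideals of quadratic orders *)

(** As the conductor is f D, the radical condition puts Q inside f D and a power
    of f inside Q, and f^2 D is inside the square of the conductor. *)
Lemma F_basic_in_D d f Q D (F := scale_ideal f%:R D) : is_subring D ->
    quad_order d f = order_of_conductor D f -> conductor d f = F -> F_basic d f Q ->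
  [/\ is_ideal (quad_order d f) Q, Q `<=` F, exists n, Q (f%:R ^+ n)
    & ~ Q `<=` scale_ideal f%:R F].
Proof.
move=> rD OE CE [[[iQ _ _] radE] NQ].
have rO : is_subring (quad_order d f) by rewrite OE; apply: order_subring.
have Ff : F f%:R by exists 1; [apply: (subring1 rD) | rewrite mulr1].
split=> //.
- move=> x Qx; rewrite -CE -radE; split; first exact: (ideal_sub iQ Qx).
  by exists 1.
- by move: Ff; rewrite -CE -radE => -[_ [n Qn]]; exists n.
move=> Qff; apply: NQ => x /Qff[_ [y Dy <-] <-]; rewrite /ideal_exp /= CE.
apply: (ideal_mul_mem Ff); rewrite -[_ * y]mulr1; apply: ideal_mul_mem (subring1 rO).
by exists y.
Qed.

Theorem theorem4p6 (d : int) (f : nat) (P : set algC) (m : nat) (beta : algC)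
  (d_sqfree : squarefreez d) (d_neq1 : d <> 1) (f_prime : prime f)
  (P_prime : is_prime_ideal (quad_maxorder d) P)
  (Pbar_prime : is_prime_ideal (quad_maxorder d) (conj_ideal d P))
  (P_neq_Pbar : P <> conj_ideal d P)
  (f_split : scale_ideal f%:R (quad_maxorder d) = ideal_mul P (conj_ideal d P))
  (m_order : is_class_order (quad_maxorder d) P m)
  (beta_D : quad_maxorder d beta)
  (beta_gen : ideal_exp (quad_maxorder d) P m = scale_ideal beta (quad_maxorder d)) :
  (Qk d f beta 0 = quad_order d f /\
   forall k, (1 <= k)%N ->
     Qk d f beta k = ideal_mul (ideal_exp (quad_maxorder d) P k) (conj_ideal d P)) /\
  [/\ forall Q, F_basic d f Q ->
        exists2 k, (1 <= k)%N &
          (scale_ideal f%:R (Qk d f beta k) `<` Q /\ Q `<=` Qk d f beta k) \/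
          (scale_ideal f%:R (conj_ideal d (Qk d f beta k)) `<` Q /\
           Q `<=` conj_ideal d (Qk d f beta k)),
      forall i j, i <> j -> Qk d f beta i <> Qk d f beta j,
      forall k Q, is_ideal (quad_order d f) Q ->
        (Qk d f beta k `<=` Q <-> exists2 i, (i <= k)%N & Q = Qk d f beta i)
    & forall Q, is_ideal (quad_order d f) Q ->
        (exists2 t, Q t & basic_elt d f t) ->
        ~ is_principal (quad_order d f) Q ->
        exists k, Q = Qk d f beta k \/ Q = conj_ideal d (Qk d f beta k)].
Proof.
have [r [s [ww wconj]]] := quad_omega_quadratic d.
have OE := quad_order_conductor f ww.
have DE := Zadjoin_quadratic ww; rewrite -/(quad_maxorder d) in DE.
have rD : is_subring (quad_maxorder d) := Zadjoin_subring _.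
have Dw : quad_maxorder d (quad_omega d) := Zadjoin_gen _.
have Dgen x : quad_maxorder d x -> exists a b : int, x = a%:~R + b%:~R * quad_omega d.
  by rewrite DE.
have Dconj x : quad_maxorder d x -> exists2 y, quad_maxorder d y & conj_rel d x y.
  move=> /Dgen[a [b ->]]; exists (a%:~R + b%:~R * (r%:~R - quad_omega d)).
    apply: (subringD rD (subring_int _ rD)); apply: (subringM rD (subring_int _ rD)).
    exact: (subringB rD (subring_int _ rD) Dw).
  exact: (conj_relD (conj_rel_int d a) (conj_relM (conj_rel_int d b) wconj)).
have DK x : quad_maxorder d x -> exists y, conj_rel d x y.
  by move=> /Dconj[y _ xy]; exists y.
have cD : conj_ideal d (quad_maxorder d) = quad_maxorder d.
  rewrite conj_idealE; apply/seteqP; split=> x.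
    by move=> [y /Dconj[z Dz yz] yx]; rewrite (conj_rel_inj d_sqfree d_neq1 yx yz).
  by move=> /Dconj[y Dy xy]; exists y => //; apply: conj_rel_sym.
have sp := split_prime_of_factorization f_prime rD Dw Dgen P_prime Pbar_prime
  P_neq_Pbar f_split.
have [m0 _ _] := m_order.
have QE k : Qk d f beta k = basic_chain (quad_maxorder d) P f k.
  by rewrite /Qk OE; apply: (basic_chain_gen k sp m0 beta_gen).
have cQE k : conj_ideal d (Qk d f beta k.+1)
    = basic_chain (quad_maxorder d) (conj_ideal d P) f k.+1.
  have iP := split_ideall sp.
  rewrite QE /= conj_ideal_scale // ?conj_ideal_exp //.
  by move=> x /(ideal_sub (split_exp_ideal sp k))/DK.
have CE : conductor d f = scale_ideal f%:R (quad_maxorder d).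
  by rewrite /conductor OE; apply: (conductor_gen_colon sp).
split; [split|split].
- by rewrite QE OE.
- by move=> [//|k] _; rewrite QE /= (split_expM_conj sp).
- move=> Q /(F_basic_in_D rD OE CE); rewrite OE => -[iQ QF [n Qn] NQ].
  have [a [R RE sandwich]] := basic_ideal_sandwich sp iQ QF Qn NQ.
  exists a.+1 => //; rewrite cQE QE.
  by case: RE => RE; [left | right]; rewrite /= -RE.
- move=> i j ij; rewrite !QE => E; apply: ij; apply/eqP.
  by rewrite eqn_leq (basic_chain_le sp E) (basic_chain_le sp (esym E)).
- move=> k Q; rewrite OE => iQ; rewrite QE; split.
    by move=> /(over_basic_chain sp iQ)[i leik QEi]; exists i; rewrite ?QE.
  by move=> [i leik ->]; rewrite QE; apply: (basic_chain_decr sp leik).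
move=> Q; rewrite OE => iQ [t Qt [Ot tbasic]] NprQ.
have [itO tOF [n tn] NtO] := F_basic_in_D rD OE CE tbasic.
have rO : is_subring (quad_order d f) by rewrite OE; apply: order_subring.
have Ft : scale_ideal f%:R (quad_maxorder d) t.
  by apply: tOF; exists 1; [apply: (subring1 rO) | rewrite mulr1].
have Nt : ~ scale_ideal f%:R (scale_ideal f%:R (quad_maxorder d)) t.
  move=> [x [y Dy <-] tE]; apply: NtO => _ [z Oz <-].
  exists (f%:R * (y * z)); last by rewrite -tE; ring.
  exists (y * z) => //; apply: (subringM rD Dy); rewrite OE in Oz.
  exact: (order_sub rD Oz).
rewrite OE in tn.
have [[|k] [] ->] := over_basic_elt sp iQ Qt Ft Nt tn NprQ.
- by exists 0%N; left; rewrite QE.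
- by exists 0%N; left; rewrite QE.
- by exists k.+1; left; rewrite QE.
by exists k.+1; right; rewrite cQE.
Qed.
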